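(* Let $\mathcal{H}$ be a complex Hilbert space, let $n$ be a positive integer, let $S_1,\dots,S_n\in\mathcal{B}(\mathcal{H})$, let $q\in(0,1]$, and let $\omega=e^{2\pi \mathrm{i}/n}$. Let $\mathbb{S}_{circ}$ be the circulant operator matrix $$\mathbb{S}_{circ}=\begin{bmatrix} S_1 & S_2 & S_3 & \cdots & S_n\\ S_n & S_1 & S_2 & \cdots & S_{n-1}\\ S_{n-1} & S_n & S_1 & \ddots & S_{n-2}\\ \vdots & \vdots & \ddots & \ddots & \vdots\\ S_2 & S_3 & \cdots & S_n & S_1\end{bmatrix}$$ acting on $\bigoplus_{j=1}^n\mathcal{H}$. Then $$\max_{0\le k\le n-1} w_q\left(\sum_{j=1}^n\omega^{k(1-j)}S_j\right)\le w_q(\mathbb{S}_{circ})\le \frac{q+2\sqrt{1-q^2}}{q}\max_{0\le k\le n-1} w_q\left(\sum_{j=1}^n\omega^{k(1-j)}S_j\right).$$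
   Context: $\mathcal{B}(\mathcal{K})$ denotes the bounded linear operators on a complex Hilbert space $\mathcal{K}$. An $n\times n$ matrix $[S_{ij}]$ with entries in $\mathcal{B}(\mathcal{H})$ acts on $\bigoplus_{j=1}^n\mathcal{H}$ (with the direct-sum inner product) by $(x_1,\dots,x_n)\mapsto(\sum_j S_{1j}x_j,\dots,\sum_j S_{nj}x_j)$. For $A\in\mathcal{B}(\mathcal{K})$ and a scalar $q$ with $|q|\le 1$, the $q$-numerical range is $W_q(A)=\{\langle Ax,y\rangle: x,y\in\mathcal{K},\ \|x\|=\|y\|=1,\ \langle x,y\rangle=q\}$ and the $q$-numerical radius is $w_q(A)=\sup\{|z|: z\in W_q(A)\}$. In the degenerate case $\dim\mathcal{K}=1$, where $A$ is a scalar $c$ and $W_q(A)$ is empty for $0<q<1$, the convention is $w_q(A)=q|c|$. *)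

(* Defs.v *)
From HB Require Import structures.
From mathcomp Require Import all_boot all_order all_algebra.
From mathcomp Require Import complex.
From mathcomp Require Import all_classical all_reals all_analysis.

Set Implicit Arguments.
Unset Strict Implicit.
Unset Printing Implicit Defensive.

Import Order.TTheory GRing.Theory Num.Theory.
Import numFieldNormedType.Exports.

Local Open Scope classical_set_scope.
Local Open Scope ring_scope.
Local Open Scope complex_scope.

HB.mixin Record CompleteNormedModule_isHilbert (R : realType) H
    & CompleteNormedModule R[i] H := {
  inner : {dot H for Num.conj} ;
  normr_inner : forall x : H, `|x| ^+ 2 = inner x x
}.

#[short(type="hilbertType")]
HB.structure Definition Hilbert (R : realType) :=
  {H of CompleteNormedModule R[i] H & CompleteNormedModule_isHilbert R H}.

Notation "''[' x , y ]" := (inner x y)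
  (at level 0, format "''['  x ,  y  ]") : ring_scope.

Section DotNorm.
Variables (C : numClosedFieldType) (U : lmodType C) (f : {dot U for Num.conj}).

Definition dot_norm (x : U) : C := sqrtC (f x x).

Lemma dot_CauchySchwarz x y : `|f x y| <= dot_norm x * dot_norm y.
Proof.
rewrite -(@ler_pXn2r _ 2)// ?nnegrE ?mulr_ge0 ?sqrt_dnorm_ge0//.
rewrite exprMn !sqrtCK.
have [->|y0] := eqVneq y 0; first by rewrite !linear0r normr0 expr0n/=.
have fy0 : 0 < f y y by rewrite dnorm_gt0.
set a := f x y; set b := f y y; set c := f x x.
have := dnorm_ge0 f (b *: x - a *: y).
rewrite dnormB (dnormZ _ b x) (dnormZ _ a y).
have -> : f (b *: x) (a *: y) = b * (Num.conj a * a).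
  by rewrite linearZl_LR linearZr_LR.
rewrite (ger0_norm (ltW fy0)) -/b -/c => h.
have bR : Num.conj b = b.
  by apply/CrealP; rewrite ger0_real// /b dnorm_ge0.
have : 0 <= b * (b * c - `|a| ^+ 2).
  suff -> : b * (b * c - `|a| ^+ 2) = b ^+ 2 * c + `|a| ^+ 2 * b -
     (b * (Num.conj a * a) + Num.conj (b * (Num.conj a * a))) by exact: h.
  rewrite !rmorphM/= conjCK bR (mulrC (Num.conj a) a) -normCK.
  by rewrite mulrBr mulrA -expr2 (mulrC _ b) opprD addrA addrK.
by rewrite pmulr_rge0// subr_ge0 mulrC.
Qed.

Lemma ler_dot_normD x y : dot_norm (x + y) <= dot_norm x + dot_norm y.
Proof.
rewrite -(@ler_pXn2r _ 2)// ?nnegrE ?addr_ge0 ?sqrt_dnorm_ge0//.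
rewrite sqrrD !sqrtCK dnormD/= addrAC lerD2r lerD2l.
have := dot_CauchySchwarz x y; set s := _ * _ => h.
have nR : f x y + Num.conj (f x y) \is Num.real.
  by apply/CrealP; rewrite rmorphD/= conjCK addrC.
rewrite (le_trans (real_ler_norm nR))//.
by rewrite (le_trans (ler_normD _ _))// norm_conjC -mulr2n lerMn2r h orbT.
Qed.

Lemma dot_normZ (a : C) x : dot_norm (a *: x) = `|a| * dot_norm x.
Proof.
by rewrite /dot_norm dnormZ rootCMl ?exprn_ge0// exprCK.
Qed.

Lemma dot_norm_eq0 x : dot_norm x = 0 -> x = 0.
Proof. by move/eqP; rewrite sqrt_dnorm_eq0 => /eqP. Qed.
End DotNorm.

Section DirectSum.
Variables (R : realType) (H : hilbertType R) (n : nat).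

(* The Hilbert direct sum of n copies of H; its norm is the l^2 norm, namely
   dot_norm dsum_inner. *)
Definition dsum : Type := {ffun 'I_n -> H}.

HB.instance Definition _ := GRing.Lmodule.copy dsum {ffun 'I_n -> H}.

Definition dsum_inner (x y : dsum) : R[i] := \sum_(i < n) '[x i, y i].

Let dsum_inner_bilinear :
  bilinear_for *%R (Num.conj \; *%R : GRing.Scale.law _ _) dsum_inner.
Proof.
split=> [y a x x'|x a y y']; rewrite /dsum_inner /= mulr_sumr -big_split/=.
  by apply: eq_bigr => i _; rewrite !ffunE linearPl.
by apply: eq_bigr => i _; rewrite !ffunE linearPr.
Qed.

HB.instance Definition _ :=
  bilinear_isBilinear.Build _ _ _ _ _ _ dsum_inner dsum_inner_bilinear.

Let dsum_inner_hermitian x y :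
  dsum_inner x y = (-1) ^+ false * Num.conj (dsum_inner y x).
Proof.
rewrite mul1r rmorph_sum; apply: eq_bigr => i _.
by rewrite hermC/= mul1r.
Qed.

HB.instance Definition _ := isHermitianSesquilinear.Build _ _ _ _ dsum_inner
  dsum_inner_hermitian.

Let dsum_inner_gt0 (x : dsum) : x != 0 -> 0 < dsum_inner x x.
Proof.
move=> x0; rewrite lt_def sumr_ge0 ?andbT => [|i _]; last exact: dnorm_ge0.
apply: contraNneq x0 => /eqP; rewrite psumr_eq0 => [/allP h|i _]; last first.
  exact: dnorm_ge0.
apply/eqP/ffunP => i; rewrite ffunE; apply/eqP.
rewrite -(dnorm_eq0 (@inner R H)).
by have := h i; rewrite mem_index_enum => /(_ isT).
Qed.

HB.instance Definition _ := isDotProduct.Build _ _ dsum_inner dsum_inner_gt0.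

HB.instance Definition _ := Lmodule_isNormed.Build R[i] dsum
  (@ler_dot_normD _ _ dsum_inner) (@dot_normZ _ _ dsum_inner)
  (@dot_norm_eq0 _ _ dsum_inner).

Let dsum_normE (x : dsum) : `|x| = dot_norm dsum_inner x.
Proof. by []. Qed.

Let dsum_norm_inner (x : dsum) : `|x| ^+ 2 = dsum_inner x x.
Proof. by rewrite dsum_normE sqrtCK. Qed.

Lemma ler_dsum_norm (x : dsum) i : `|x i| <= `|x|.
Proof.
rewrite -(@ler_pXn2r _ 2)// ?nnegrE// dsum_norm_inner /dsum_inner.
rewrite (bigD1 i)//= normr_inner lerDl sumr_ge0// => j _; exact: dnorm_ge0.
Qed.

Lemma ler_dsum_norm_sum (x : dsum) : `|x| <= \sum_(i < n) `|x i|.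
Proof.
rewrite -(@ler_pXn2r _ 2)// ?nnegrE ?sumr_ge0// dsum_norm_inner /dsum_inner.
rewrite expr2 mulr_suml ler_sum// => i _.
rewrite -normr_inner expr2 ler_wpM2l// (bigD1 i)//= lerDl sumr_ge0//.
Qed.

Let dsum_complete (F : set_system dsum) : ProperFilter F -> cauchy F -> cvg F.
Proof.
move=> FF Fc; apply/cvg_ex.
have Fi i : cvg ((fun x : dsum => x i) @ F).
  apply: cauchy_cvg; apply/cauchy_ballP => e e0.
  have /cauchy_ballP/(_ e e0) := Fc.
  rewrite !near_simpl => -[[A B] /= [FA FB] AB].
  exists ((fun x : dsum => x i) @` A, (fun x : dsum => x i) @` B).
    split => /=; first by apply: filterS FA => x Ax; exists x.
    by apply: filterS FB => x Bx; exists x.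
  move=> [_ _] /= [[x Ax <-] [y By <-]].
  have := AB (x, y) (conj Ax By); rewrite /= -!ball_normE/=.
  apply: le_lt_trans; have := ler_dsum_norm (x - y) i.
  by rewrite !ffunE.
pose l : dsum := [ffun i => lim ((fun x : dsum => x i) @ F)].
exists l; apply/cvgrPdist_lt => e e0.
have en : 0 < e / n.+1%:R by rewrite divr_gt0.
have near_i i : F [set x : dsum | `|l i - x i| < e / n.+1%:R].
  by rewrite ffunE; have /cvgrPdist_lt := Fi i; apply.
have near_l := filter_forall (F := F) (@filter_filter _ _ FF) near_i.
apply: filterS near_l => x xl; apply: le_lt_trans (ler_dsum_norm_sum _) _.
apply: (@le_lt_trans _ _ (\sum_(i < n) e / n.+1%:R)).
  apply: ler_sum => i _; apply: ltW; have := xl i.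
  by rewrite /= (_ : (l - x) i = l i - x i)// !ffunE.
rewrite sumr_const card_ord -[ltLHS]mulr_natr mulrAC -mulrA gtr_pMr//.
by rewrite ltr_pdivrMr// mul1r ltr_nat.
Qed.

HB.instance Definition _ := Uniform_isComplete.Build dsum dsum_complete.

HB.instance Definition _ :=
  CompleteNormedModule_isHilbert.Build R dsum dsum_norm_inner.

End DirectSum.

Section BoundedOperators.
Variables (R : realType) (K : hilbertType R).

Definition bounded_linear : {pred K -> K} := fun A =>
  `[< linear A /\ exists M : R, forall x, `|A x| <= M%:C * `|x| >].

Let bounded_linear_submod : submod_closed bounded_linear.
Proof.
split.
  apply/asboolP; split; first by move=> a x y; rewrite scaler0 addr0.
  by exists 0 => x; rewrite normr0 mul0r.
move=> a A B /asboolP[lA [M AM]] /asboolP[lB [N BN]]; apply/asboolP; split.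
  move=> b x y; rewrite /= !fctE lA lB !scalerDr !scalerA (mulrC a).
  by rewrite addrACA.
have /complex_realP[r ra] := normr_real a.
exists (r * M + N) => x; rewrite !fctE (le_trans (ler_normD _ _))//.
rewrite rmorphD rmorphM mulrDl lerD// normrZ ra -mulrA ler_wpM2l//.
by rewrite -ra.
Qed.

HB.instance Definition _ := GRing.isSubmodClosed.Build R[i] (K -> K)
  bounded_linear bounded_linear_submod.

Record bounded_op := BoundedOp {
  bounded_op_fun :> K -> K ;
  bounded_op_subproof : bounded_op_fun \in bounded_linear }.

HB.instance Definition _ := [isSub for bounded_op_fun].
HB.instance Definition _ := [Choice of bounded_op by <:].
HB.instance Definition _ := [SubChoice_isSubLmodule of bounded_op by <:].

End BoundedOperators.

Notation "''B' ( K )" := (bounded_op K)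
  (at level 8, format "''B' ( K )") : type_scope.

Section OperatorMatrix.
Variables (R : realType) (H : hilbertType R) (n : nat).

Definition opmx_fun (S : 'M['B(H)]_n) (x : dsum H n) : dsum H n :=
  [ffun i => \sum_(j < n) S i j (x j)].

Let opmx_bounded_linear (S : 'M['B(H)]_n) :
  opmx_fun S \in @bounded_linear R (dsum H n).
Proof.
have SB i j := asboolW (bounded_op_subproof (S i j)).
apply/asboolP; split.
  move=> a x y; apply/ffunP => i; rewrite !ffunE scaler_sumr -big_split/=.
  by apply: eq_bigr => j _; rewrite !ffunE; case: (SB i j) => + _; apply.
have /choice[M SM] (ij : 'I_n * 'I_n) : exists M : R,
    0 <= M /\ forall x, `|S ij.1 ij.2 x| <= M%:C * `|x|.
  have [_ [M SM]] := SB ij.1 ij.2.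
  exists (Num.max M 0); split=> [|x]; first by rewrite le_max lexx orbT.
  by rewrite (le_trans (SM x))// ler_wpM2r// lecR le_max lexx.
exists (\sum_(i < n) \sum_(j < n) M (i, j)) => x.
rewrite (le_trans (ler_dsum_norm_sum _))// rmorph_sum mulr_suml ler_sum// => i _.
rewrite ffunE (le_trans (ler_norm_sum _ _ _))//.
rewrite rmorph_sum mulr_suml ler_sum// => j _.
have [M0 SMij] := SM (i, j); rewrite (le_trans (SMij _))// ler_wpM2l ?lecR//.
exact: ler_dsum_norm.
Qed.

Definition opmx (S : 'M['B(H)]_n) : 'B(dsum H n) :=
  BoundedOp (opmx_bounded_linear S).

Let ord_lt (i : 'I_n) (m : nat) : (m %% n < n)%N.
Proof. by rewrite ltn_mod (leq_ltn_trans (leq0n i) (ltn_ord i)). Qed.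

(* S i stands for the operator usually numbered i + 1: entry (i, j) of the
   circulant matrix is S ((j - i) mod n), so that its first row is
   S 0, ..., S (n - 1) and each row is the cyclic right shift of the previous. *)
Definition circmx (S : 'I_n -> 'B(H)) : 'M['B(H)]_n :=
  \matrix_(i < n, j < n) S (Ordinal (ord_lt i (j + (n - i)))).

End OperatorMatrix.

Section QNumericalRadius.
Variables (R : realType) (K : hilbertType R).

Definition qnum_range (q : R[i]) (A : 'B(K)) : set R[i] :=
  [set z | exists x y : K,
    [/\ `|x| = 1, `|y| = 1, '[x, y] = q & z = '[A x, y]]].

(* On a one-dimensional space qnum_range q A is empty when `|q| < 1, and the
   radius is by convention `|q| * `|c| where A is the scalar c; for `|q| = 1 this
   agrees with the supremum. On the zero space the supremum of the empty set is
   0. *)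
Definition one_dimensional : Prop :=
  exists2 e : K, e != 0 & forall x, exists c : R[i], x = c *: e.

Definition scalar_of (A : 'B(K)) : R[i] :=
  xget 0 [set c | forall x, A x = c *: x].

Definition qnum_radius (q : R[i]) (A : 'B(K)) : R :=
  if `[< one_dimensional >] then complex.Re `|q * scalar_of A|
  else sup [set complex.Re `|z| | z in qnum_range q A].

(* Hence \big[Num.max/0] of radii over a nonempty range is their maximum. *)
Lemma qnum_radius_ge0 q A : 0 <= qnum_radius q A.
Proof.
have normRe_ge0 (z : R[i]) : 0 <= complex.Re `|z|.
  by rewrite -lecR RRe_real ?normr_real ?normr_ge0.
rewrite /qnum_radius; case: ifPn => // _.
have [->|/set0P[z Wz]] := eqVneq (qnum_range q A) set0.
  by rewrite image_set0 sup0.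
have [ub|nub] := pselect (has_ubound [set complex.Re `|z| | z in qnum_range q A]).
  by apply: (le_trans (normRe_ge0 z)); apply: ub_le_sup => //; exists z.
by rewrite sup_out// => -[].
Qed.

End QNumericalRadius.

Definition cexp (R : realType) (z : R[i]) : R[i] :=
  (expR (complex.Re z))%:C * (cos (complex.Im z) +i* sin (complex.Im z)).

Definition omega (R : realType) (n : nat) : R[i] :=
  cexp (2 * pi / n%:R)*i.

(* Main.v *)
Require Import Defs.
From HB Require Import structures.
From mathcomp Require Import all_boot all_order all_algebra.
From mathcomp Require Import complex.
From mathcomp Require Import all_classical all_reals all_analysis.
From mathcomp Require Import ring.

Set Implicit Arguments.
Unset Strict Implicit.
Unset Printing Implicit Defensive.

Import Order.TTheory GRing.Theory Num.Theory.

Local Open Scope ring_scope.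
Local Open Scope complex_scope.

(** Write zeta for the inverse of omega. The circulant C commutes with the
    cyclic shift, so it leaves the eigenspaces of the shift invariant. These are
    the spaces of plane waves (zeta ^ (k j) u)_j, u in H, and C acts there as
    T_k = \sum_j zeta ^ (k j) S_j (lemma [circmx_plane_wave]); these T_k are the
    operators of the statement. The discrete Fourier transform decomposes every
    vector of the direct sum into plane waves, hence C is unitarily equivalent
    to the direct sum of the T_k.

    Lower bound. Normalized plane waves embed H isometrically in the direct sum
    and intertwine T_k with C, so that W_q(T_k) is contained in W_q(C)
    ([qnum_radius_isometry]).

    Upper bound. The comparison goes through the usual numerical radius w.
    Three facts are used:
    - q w(T) <= w_q(T) ([quadratic_form_le_qnum_radius]): if z is a unit vector
      orthogonal to the unit vector x and r = sqrt (1 - q^2), then both vectors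
      q x + r z and q x - r z are admissible partners of x, and the average of
      the two resulting points of W_q(T) is q <T x, x>;
    - w(C) <= max_k w(T_k) ([circmx_numerical_bound]), as the quadratic form of
      C is the sum of those of the T_k at the normalized Fourier
      coefficients;
    - w_q(C) <= (q + 2 r) w(C) ([qnum_radius_le]): unit vectors with
      <x, y> = q satisfy
      y = q x + z with z orthogonal to x and of norm r, and
      |<C x, z>| <= 2 w(C) |z| by polarization.
    Together, w_q(C) <= (q + 2 r) max_k w(T_k) <= (q + 2 r) / q max_k w_q(T_k).

    The one-dimensional convention matters because H may be a line while the
    direct sum is not; w_q(T_k) = q w(T_k) then, by that convention. Lemmas
    [le_qnum_radius] and [ge_qnum_radius] compare radii in all dimensions. *)

(** * Inner product and linearity *)

HB.instance Definition _ (R : realType) (K : hilbertType R) (A : 'B(K)) :=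
  GRing.isLinear.Build R[i] K K _ (bounded_op_fun A)
    (asboolW (bounded_op_subproof A)).1.

Section Hilbert.
Variables (R : realType) (K : hilbertType R).
Implicit Types (x y z : K) (a : R[i]).

Lemma opD (A : 'B(K)) x y : A (x + y) = A x + A y.
Proof. exact: linearD. Qed.

Lemma opZ (A : 'B(K)) a x : A (a *: x) = a *: A x.
Proof. exact: linearZ. Qed.

Lemma innerDl x y z : '[x + y, z] = '[x, z] + '[y, z].
Proof. exact: linearDl. Qed.

Lemma innerDr x y z : '[x, y + z] = '[x, y] + '[x, z].
Proof. exact: linearDr. Qed.

Lemma innerZl a x y : '[a *: x, y] = a * '[x, y].
Proof. exact: linearZl_LR. Qed.

Lemma innerZr a x y : '[x, a *: y] = Num.conj a * '[x, y].
Proof. exact: linearZr_LR. Qed.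

Lemma inner_suml (I : finType) (F : I -> K) x :
  '[\sum_i F i, x] = \sum_i '[F i, x].
Proof. exact: linear_sumlz. Qed.

Lemma inner_sumr (I : finType) (F : I -> K) x :
  '[x, \sum_i F i] = \sum_i '[x, F i].
Proof. exact: linear_sumr. Qed.

Lemma innerC x y : '[x, y] = Num.conj '[y, x].
Proof. by rewrite hermC mul1r. Qed.

Lemma conj_realC (r : R) : Num.conj r%:C = r%:C :> R[i].
Proof. by apply/CrealP/complex_realP; exists r. Qed.

Lemma norm_realC (r : R) : 0 <= r -> `|r%:C| = r%:C :> R[i].
Proof. by move=> r0; rewrite ger0_norm ?ler0c. Qed.

Lemma Re_normc (a : R[i]) : (complex.Re `|a|)%:C = `|a|.
Proof. by rewrite RRe_real ?normr_real. Qed.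

Lemma inner_CauchySchwarz x y : `|'[x, y]| <= `|x| * `|y|.
Proof.
have := dot_CauchySchwarz (@inner R K) x y.
by rewrite /dot_norm -!normr_inner !sqrCK.
Qed.

Lemma norm1_inner x : `|x| = 1 <-> '[x, x] = 1.
Proof.
rewrite -normr_inner; split=> [->|/eqP]; first by rewrite expr1n.
by rewrite sqrp_eq1// => /eqP.
Qed.

Lemma norm_orthonormal_comb x z (a b : R[i]) :
  `|x| = 1 -> `|z| = 1 -> '[z, x] = 0 ->
  `|a| ^+ 2 + `|b| ^+ 2 = 1 -> `|a *: x + b *: z| = 1.
Proof.
move=> /norm1_inner x1 /norm1_inner z1 zx ab; apply/norm1_inner.
have xz : '[x, z] = 0 by rewrite innerC zx rmorph0.
rewrite innerDl !innerDr !innerZl !innerZr xz zx x1 z1 !mulr0 addr0 add0r.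
by rewrite !mulr1 -!normCK.
Qed.

Lemma parallelogram x y :
  `|x + y| ^+ 2 + `|x - y| ^+ 2 = 2 * (`|x| ^+ 2 + `|y| ^+ 2).
Proof.
rewrite !normr_inner (@dnormD _ _ inner x y) (@dnormB _ _ inner x y).
by rewrite addrACA subrr addr0 mulr2n mulrDl mul1r.
Qed.

(** Some vector is not a multiple of x: subtract its projection on x. *)
Lemma exists_unit_orthogonal x : `|x| = 1 -> ~ one_dimensional K ->
  exists2 z, `|z| = 1 & '[z, x] = 0.
Proof.
move=> x1 K1; have xn0 : x != 0 by rewrite -normr_eq0 x1 oner_neq0.
have [v vx] : exists v, v - '[v, x] *: x != 0.
  apply: contrapT => /forallNP h; apply: K1; exists x => // v.
  by exists '[v, x]; apply/eqP; rewrite -subr_eq0; apply/negPn/negP/h.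
set w := _ - _ in vx.
have w0 : '[w, x] = 0.
  rewrite /w innerDl -scaleNr innerZl.
  by move/norm1_inner : x1 => ->; rewrite mulr1 subrr.
exists (`|w|^-1 *: w); last by rewrite innerZl w0 mulr0.
by rewrite normrZ normfV normr_id mulVf// normr_eq0.
Qed.

(** * Numerical radius and q-numerical radius *)

Section NumericalRadius.
Variable A : 'B(K).

Lemma scalar_ofE : one_dimensional K -> forall x, A x = scalar_of A *: x.
Proof.
move=> [e e0 eK];
apply: (@xgetPex _ 0 [set c | forall x, A x = c *: x]%classic).
have [c Ae] := eK (A e); exists c => x; have [d ->] := eK x.
by rewrite opZ Ae !scalerA mulrC.
Qed.

Lemma has_ubound_qnum_range (q : R[i]) :
  has_ubound [set complex.Re `|z| | z in qnum_range q A]%classic.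
Proof.
have [_ [M AM]] := asboolW (bounded_op_subproof A).
exists M => _ [_ [x [y [x1 y1 _ ->]]] <-]; rewrite -lecR Re_normc.
rewrite (le_trans (inner_CauchySchwarz _ _))// y1 mulr1.
by rewrite (le_trans (AM x))// x1 mulr1.
Qed.

Lemma le_qnum_radius (q z : R[i]) :
  qnum_range q A z -> `|z| <= (qnum_radius q A)%:C.
Proof.
move=> qz; rewrite -Re_normc lecR /qnum_radius; case: asboolP => [K1|_].
  have [x [y [_ _ xy ->]]] := qz.
  by rewrite (scalar_ofE K1) innerZl xy mulrC.
by apply: (ub_le_sup (has_ubound_qnum_range q)); exists z.
Qed.

(** The bound on the quadratic form serves the one-dimensional case, where
    the q-numerical range may be empty and the radius is |q| |c|; the bound on
    the range serves the others. *)
Lemma ge_qnum_radius (q : R[i]) (m : R) : 0 <= m ->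
  (forall x : K, `|q * '[A x, x]| <= m%:C * `|x| ^+ 2) ->
  (forall z : R[i], qnum_range q A z -> `|z| <= m%:C) -> qnum_radius q A <= m.
Proof.
move=> m0 Am qm; rewrite /qnum_radius; case: asboolP => [K1|_].
  have [e e0 _] := K1; rewrite -lecR Re_normc.
  have := Am e; rewrite (scalar_ofE K1) innerZl -normr_inner mulrA.
  by rewrite normrM [X in _ * X]ger0_norm ?ler_pM2r// ?exprn_gt0 ?normr_gt0.
have [W0|W0] := pselect (qnum_range q A !=set0)%classic; last first.
  by move/set0P/negP/negPn/eqP : W0 => ->; rewrite image_set0 sup0.
apply: ge_sup => [|_ [z qz <-]].
  by case: W0 => z; exists (complex.Re `|z|), z.
by rewrite -lecR Re_normc; exact: qm.
Qed.

(** q w(A) <= w_q(A): the point q <A x, x> is the midpoint of the two points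
    of the q-numerical range given by the partners q x + r z and q x - r z of a
    unit vector x, where z is a unit vector orthogonal to x. *)
Lemma quadratic_form_le_qnum_radius (q : R) x : 0 <= q <= 1 ->
  q%:C * `|'[A x, x]| <= (qnum_radius q%:C A)%:C * `|x| ^+ 2.
Proof.
move=> /andP[q0 q1]; have [K1|K1] := pselect (one_dimensional K).
  rewrite /qnum_radius asboolT// Re_normc (scalar_ofE K1) innerZl -normr_inner.
  rewrite (normrM (scalar_of A)) (normrM q%:C) norm_realC// normrX normr_id.
  by rewrite mulrA.
wlog x1 : x / `|x| = 1.
  move=> wl; have [->|x0] := eqVneq x 0.
    by rewrite linear0r !normr0 expr0n !mulr0.
  have nx0 : `|x| != 0 by rewrite normr_eq0.
  pose u := `|x|^-1 *: x.
  have u1 : `|u| = 1 by rewrite normrZ normfV normr_id mulVf.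
  have -> : `|'[A x, x]| = `|'[A u, u]| * `|x| ^+ 2.
    rewrite opZ innerZl innerZr !normrM norm_conjC normfV normr_id.
    by rewrite mulrA -expr2 mulrC mulrA -exprMn mulfV// expr1n mul1r.
  rewrite mulrA ler_wpM2r ?exprn_ge0//.
  by have := wl _ u1; rewrite u1 expr1n mulr1.
have [z z1 zx] := exists_unit_orthogonal x1 K1.
pose r := Num.sqrt (1 - q ^+ 2).
pose y (b : bool) := q%:C *: x + ((-1) ^+ b * r%:C) *: z.
have Wy b : qnum_range q%:C A '[A x, y b].
  exists x, (y b); split=> //.
    rewrite norm_orthonormal_comb// normrMsign !norm_realC ?sqrtr_ge0//.
    rewrite -!rmorphXn -rmorphD sqr_sqrtr ?subrKC//.
    by rewrite subr_ge0 expr_le1.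
  rewrite innerDr !innerZr (innerC x z) zx rmorph0 mulr0 addr0 conj_realC.
  by move/norm1_inner : x1 => ->; rewrite mulr1.
have -> : q%:C * `|'[A x, x]| = `|'[A x, y false] + '[A x, y true]| / 2.
  rewrite !innerDr !innerZr !rmorphM rmorph1 rmorphN1 !conj_realC.
  rewrite mul1r mulN1r mulNr addrACA subrr addr0 -mulr2n normrMn normrM.
  by rewrite norm_realC// -[X in X / _]mulr_natr mulfK// pnatr_eq0.
rewrite ler_pdivrMr// x1 expr1n mulr1 mulr_natr mulr2n.
by rewrite (le_trans (ler_normD _ _))// lerD// le_qnum_radius.
Qed.

Section NumericalBound.
Variables (m : R) (Am : forall x, `|'[A x, x]| <= m%:C * `|x| ^+ 2).

(** Subtracting the quadratic forms at x + z and x - z leaves twice this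
    symmetrized form, and the parallelogram identity adds up the two bounds. *)
Lemma symmetric_form_bound x z :
  `|'[A x, z] + '[A z, x]| <= m%:C * (`|x| ^+ 2 + `|z| ^+ 2).
Proof.
rewrite -(ler_pM2l (ltr0n _ 2)) mulrCA -parallelogram mulrDr.
have -> : 2 * `|'[A x, z] + '[A z, x]| =
    `|'[A (x + z), x + z] - '[A (x - z), x - z]|.
  rewrite -[2 in LHS]normr_nat -normrM; congr (`|_|).
  rewrite -[- z]scaleN1r !opD opZ !innerDl !innerDr !innerZl !innerZr rmorphN1.
  by ring.
by rewrite (le_trans (ler_normB _ _))// lerD// Am.
Qed.

(** Combining the symmetrized form at z and at 'i z cancels <A z, x>. *)
Lemma polarization_bound x z : `|'[A x, z]| <= m%:C * (`|x| ^+ 2 + `|z| ^+ 2).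
Proof.
rewrite -(ler_pM2l (ltr0n _ 2)).
have -> : 2 * `|'[A x, z]| = `|('[A x, z] + '[A z, x]) +
    'i * ('[A x, 'i *: z] + '[A ('i *: z), x])|.
  rewrite opZ innerZl innerZr conjCi mulrDr !mulrA mulrN -expr2 sqrCi.
  rewrite opprK mul1r mulN1r addrACA subrr addr0 -mulr2n normrMn.
  by rewrite mulr_natl.
rewrite (le_trans (ler_normD _ _))// normrM normCi mul1r mulr_natl mulr2n.
rewrite lerD ?symmetric_form_bound// (le_trans (symmetric_form_bound _ _))//.
by rewrite normrZ normCi mul1r.
Qed.

(** Rescaling x and z to unit vectors turns the sum of squares into 2. This is
    the inequality ||A|| <= 2 w(A). *)
Lemma sesquilinear_form_bound x z : `|'[A x, z]| <= 2 * m%:C * (`|x| * `|z|).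
Proof.
have [->|x0] := eqVneq x 0.
  by rewrite (linear0 A) linear0l !normr0 mul0r mulr0.
have [->|z0] := eqVneq z 0.
  by rewrite linear0r !normr0 !mulr0.
have nx0 : `|x| != 0 by rewrite normr_eq0.
have nz0 : `|z| != 0 by rewrite normr_eq0.
have := polarization_bound (`|x|^-1 *: x) (`|z|^-1 *: z).
rewrite opZ innerZl innerZr !normrZ !normrM norm_conjC !normfV !normr_id.
rewrite !mulVf// expr1n -[1 + 1]/(2%:R) mulrA -invfM.
rewrite mulrC ler_pdivrMr ?mulr_gt0 ?normr_gt0//.
by rewrite (mulrC m%:C).
Qed.

(** A partner y of x splits as q x + z, with z orthogonal to x and of norm
    sqrt (1 - q ^ 2). *)
Lemma qnum_radius_le (q : R) : 0 <= m -> 0 <= q <= 1 ->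
  qnum_radius q%:C A <= (q + 2 * Num.sqrt (1 - q ^+ 2)) * m.
Proof.
move=> m0 /andP[q0 q1]; set r := Num.sqrt _.
have r0 : 0 <= r by exact: sqrtr_ge0.
have rm0 : 0 <= 2 * r * m by rewrite !mulr_ge0.
apply: ge_qnum_radius => [|x|_ [x [y [x1 y1 xy ->]]]].
- by rewrite mulrDl addr_ge0// mulr_ge0.
- rewrite normrM norm_realC// (le_trans (ler_wpM2l _ (Am x))) ?ler0c//.
  by rewrite mulrA ler_wpM2r ?exprn_ge0// -rmorphM lecR mulrDl lerDl.
pose z := y - q%:C *: x.
have yE : y = q%:C *: x + z by rewrite addrC subrK.
have z2 : `|z| ^+ 2 = (1 - q ^+ 2)%:C.
  rewrite normr_inner (@dnormB _ _ inner) dnormZ innerZr innerC xy.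
  move/norm1_inner : x1 => ->; move/norm1_inner : y1 => ->.
  rewrite !conj_realC norm_realC// -!rmorphM conj_realC mulr1.
  by rewrite -expr2 -!rmorphXn opprD addrA addrK rmorphB rmorph1.
have zr : `|z| = r%:C.
  apply/eqP; rewrite -(@eqrXn2 _ 2)// ?ler0c// z2 -rmorphXn sqr_sqrtr//.
  by rewrite subr_ge0 expr_le1.
rewrite yE innerDr innerZr conj_realC (le_trans (ler_normD _ _))//.
rewrite mulrDl rmorphD lerD// ?normrM.
  rewrite norm_realC// rmorphM ler_wpM2l ?ler0c//.
  by rewrite (le_trans (Am x))// x1 expr1n mulr1.
rewrite (le_trans (sesquilinear_form_bound _ _))// x1 mul1r zr.
by rewrite mulrAC !rmorphM rmorph_nat.
Qed.

End NumericalBound.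
End NumericalRadius.
End Hilbert.

(** The q-numerical range of T is contained in that of C. When H is a line
    and K is not, w_q(T) is q |c| by convention, and this is at most w_q(C)
    since it is q times the value of the quadratic form of C at a unit
    vector of the image of V. *)
Lemma qnum_radius_isometry (R : realType) (H K : hilbertType R) (T : 'B(H))
    (C : 'B(K)) (V : H -> K) (q : R) : 0 <= q <= 1 ->
  (forall x y, '[V x, V y] = '[x, y]) -> (forall x, C (V x) = V (T x)) ->
  qnum_radius q%:C T <= qnum_radius q%:C C.
Proof.
move=> /andP[q0 q1] VV CV.
have Vn x : `|V x| ^+ 2 = `|x| ^+ 2 by rewrite !normr_inner VV.
apply: ge_qnum_radius => [|x|_ [x [y [x1 y1 xy ->]]]].
- exact: qnum_radius_ge0.
- rewrite -VV -CV -Vn normrM norm_realC//.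
  by apply: quadratic_form_le_qnum_radius; rewrite q0.
apply: le_qnum_radius; exists (V x), (V y); rewrite VV CV VV.
by split=> //; apply/norm1_inner; rewrite VV; apply/norm1_inner.
Qed.

(** * Roots of unity *)

Section RootsOfUnity.
Variables (C : numClosedFieldType) (n : nat) (zeta : C).
Hypothesis prim : n.-primitive_root zeta.

Lemma norm_primitive_root : `|zeta| = 1.
Proof.
apply/eqP; rewrite -(@pexpr_eq1 _ _ n) ?(prim_order_gt0 prim)//.
by rewrite -normrX (prim_expr_order prim) normr1.
Qed.

Lemma exp_primitive_rootJ m : zeta ^+ m * Num.conj (zeta ^+ m) = 1.
Proof. by rewrite -normCK normrX norm_primitive_root !expr1n. Qed.

Lemma primitive_rootV : n.-primitive_root zeta^-1.
Proof.
have -> : zeta^-1 = Num.conj zeta.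
  by rewrite invC_norm norm_primitive_root expr1n invr1 mul1r.
by rewrite fmorph_primitive_root.
Qed.

Lemma sum_root_orthogonality (i j : 'I_n) :
  \sum_(k < n) zeta ^+ (k * i) * Num.conj (zeta ^+ (k * j)) = n%:R *+ (i == j).
Proof.
pose w := zeta ^+ i * Num.conj (zeta ^+ j).
have wn : w ^+ n = 1.
  rewrite exprMn -rmorphXn -!exprM ![(_ * n)%N]mulnC !exprM.
  by rewrite (prim_expr_order prim) !expr1n rmorph1 mulr1.
have -> : \sum_(k < n) zeta ^+ (k * i) * Num.conj (zeta ^+ (k * j)) =
    \sum_(k < n) w ^+ k.
  apply: eq_bigr => k _.
  by rewrite /w exprMn -rmorphXn -!exprM ![(_ * k)%N]mulnC.
case: eqVneq => [ij|ij].
  rewrite (eq_bigr (fun=> 1)) ?sumr_const ?card_ord// => k _.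
  by rewrite /w ij exp_primitive_rootJ expr1n.
have w1 : w - 1 != 0.
  apply: contraNneq ij => /eqP; rewrite subr_eq0 => /eqP wE.
  apply/eqP/val_inj/eqP => /=.
  rewrite -(modn_small (ltn_ord i)) -(modn_small (ltn_ord j)).
  rewrite -(eq_prim_root_expr prim) -[eqbLHS]mulr1 -(exp_primitive_rootJ j).
  by rewrite mulrCA -/w wE mulr1.
by apply: (mulfI w1); rewrite -subrX1 wn subrr mulr0.
Qed.

End RootsOfUnity.

Lemma cexp_imM (R : realType) (t : R) m : cexp (t*i) ^+ m = cexp ((t *+ m)*i).
Proof.
rewrite /cexp /= expR0 !mul1r; elim: m => [|m IH].
  by rewrite expr0 mulr0n cos0 sin0.
by rewrite exprS IH mulrS cosD sinD; simpc; rewrite (addrC (sin t * _)).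
Qed.

(** If 0 < m < n then sin (pi m / n) > 0, and
    cos (2 pi m / n) = 1 - 2 sin (pi m / n) ^ 2 differs from 1. *)
Lemma omega_primitive (R : realType) n : (0 < n)%N ->
  n.-primitive_root (omega R n).
Proof.
move=> n0; apply/andP; split=> //; apply/forallP => i; apply/eqP.
rewrite unity_rootE /omega cexp_imM; apply/eqP/eqP => [e1|in1]; last first.
  rewrite in1.
  have -> : 2 * pi / n%:R *+ n = pi *+ 2 :> R.
    rewrite -mulrnAr -[_^-1 *+ n]mulr_natr mulVf ?pnatr_eq0 -?lt0n//.
    by rewrite mulr1 mulr_natl.
  by rewrite /cexp/= expR0 cos2pi sin2pi mul1r.
apply/eqP; rewrite eqn_leq ltn_ord leqNgt; apply/negP => i_lt_n.
pose a : R := pi / n%:R *+ i.+1.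
have sa : 0 < sin a.
  have -> : a = pi * (i.+1%:R / n%:R) by rewrite /a -mulrnAl -mulr_natr mulrA.
  apply: sin_gt0_pi; rewrite mulr_gt0 ?divr_gt0 ?pi_gt0 ?ltr0n//=.
  by rewrite gtr_pMr ?pi_gt0// ltr_pdivrMr ?ltr0n// mul1r ltr_nat.
have : cos (a *+ 2) = 1.
  move: e1; rewrite /cexp/= expR0 mul1r => -[+ _].
  by rewrite -mulrnAC -mulrA mulr_natl.
rewrite cos_mulr2n cos2sin2 => /eqP; rewrite -subr_eq0.
have -> : (1 - sin a ^+ 2) *+ 2 - 1 - 1 = - (sin a ^+ 2 *+ 2) by ring.
by rewrite oppr_eq0 mulrn_eq0/= expf_eq0/= gt_eqF.
Qed.

(** * Fourier analysis of the circulant *)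

Section Circulant.
Variables (R : realType) (H : hilbertType R) (n : nat) (S : 'I_n -> 'B(H)).
Variable zeta : R[i].
Hypothesis prim : n.-primitive_root zeta.
Implicit Types (k : 'I_n) (u v : H) (x : dsum H n).

Local Notation C := (opmx (circmx S)).

Definition plane_wave k u : dsum H n := [ffun j : 'I_n => zeta ^+ (k * j) *: u].

Definition dft k x : H := \sum_(j < n) Num.conj (zeta ^+ (k * j)) *: x j.

Definition symbol k : 'B(H) := \sum_(j < n) zeta ^+ (k * j) *: S j.

Lemma op_sumE (I : finType) (F : I -> 'B(H)) u : (\sum_i F i) u = \sum_i F i u.
Proof. by rewrite -[LHS]/(val (\sum_i F i) u) raddf_sum fct_sumE. Qed.

Lemma op_suml (K : hilbertType R) (A : 'B(K)) (I : finType) (F : I -> K) :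
  A (\sum_i F i) = \sum_i A (F i).
Proof. exact: linear_sum. Qed.

(** Fourier inversion on the cyclic group of order n. *)
Lemma plane_wave_dft x : x = n%:R^-1 *: \sum_(k < n) plane_wave k (dft k x).
Proof.
apply/ffunP => i; rewrite !ffunE sum_ffunE.
under eq_bigr => k _ do rewrite ffunE /dft scaler_sumr.
rewrite exchange_big/=.
under eq_bigr => j _.
  under eq_bigr => k _ do rewrite scalerA.
  rewrite -scaler_suml (sum_root_orthogonality prim).
  over.
rewrite (bigD1 i)//= eqxx big1 => [|j ji]; last first.
  by rewrite eq_sym (negPf ji) scale0r.
rewrite addr0 scalerA mulVf ?scale1r// pnatr_eq0 -lt0n.
exact: prim_order_gt0 prim.
Qed.

(** [plane_wave k] and [dft k] are adjoint to each other. *)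
Lemma inner_plane_wave k u x : '[plane_wave k u, x] = '[u, dft k x].
Proof.
rewrite -[LHS]/(\sum_(j < n) '[plane_wave k u j, x j]) /dft inner_sumr.
by apply: eq_bigr => j _; rewrite ffunE innerZl innerZr conjCK.
Qed.

Lemma dft_plane_wave k u : dft k (plane_wave k u) = n%:R *: u.
Proof.
rewrite /dft; under eq_bigr => j _.
  rewrite ffunE scalerA mulrC (exp_primitive_rootJ prim) scale1r.
  over.
by rewrite sumr_const card_ord scaler_nat.
Qed.

(** Entry (i, j) of C depends on j - i only: summing over m = j - i mod n
    takes the factor zeta ^ (k i) out of row i. *)
Lemma circmx_plane_wave k u : C (plane_wave k u) = plane_wave k (symbol k u).
Proof.
apply/ffunP => i; rewrite !ffunE /symbol op_sumE scaler_sumr.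
pose shift (m : 'I_n) : 'I_n :=
  Ordinal (ltn_pmod (m + i) (prim_order_gt0 prim)).
have shift_inj : injective shift.
  move=> m m' /(congr1 val)/= /eqP; rewrite eqn_modDr !modn_small// => /eqP.
  exact: val_inj.
rewrite (reindex_inj shift_inj)/=; apply: eq_bigr => m _.
rewrite mxE ffunE opZ.
rewrite -[RHS]/(zeta ^+ (k * i) *: (zeta ^+ (k * m) *: S m u)).
rewrite scalerA; congr (_ *: S _ u).
  rewrite -exprD -mulnDr addnC !exprM expr_mod//.
  by rewrite -exprM mulnC exprM (prim_expr_order prim) expr1n.
apply: val_inj => /=; rewrite modnDml -addnA subnKC ?modnDr ?modn_small//.
exact: ltnW.
Qed.

Lemma dft_parseval x : '[x, x] = n%:R^-1 * \sum_(k < n) '[dft k x, dft k x].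
Proof.
rewrite {1}(plane_wave_dft x) innerZl inner_suml; congr (_ * _).
by apply: eq_bigr => k _; rewrite inner_plane_wave.
Qed.

Lemma circmx_form x :
  '[C x, x] = n%:R^-1 * \sum_(k < n) '[symbol k (dft k x), dft k x].
Proof.
rewrite {1}(plane_wave_dft x) opZ op_suml innerZl inner_suml; congr (_ * _).
by apply: eq_bigr => k _; rewrite circmx_plane_wave inner_plane_wave.
Qed.

(** Plane waves of amplitude u have norm sqrt n |u|, so dividing them by sqrt n
    gives an isometry. *)
Lemma qnum_radius_symbol_le (q : R) k : 0 <= q <= 1 ->
  qnum_radius q%:C (symbol k) <= qnum_radius q%:C C.
Proof.
move=> q01; have n0 : (0 < n)%N := prim_order_gt0 prim.
pose c : R := (Num.sqrt n%:R)^-1.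
pose V u := c%:C *: plane_wave k u.
apply: (@qnum_radius_isometry _ _ _ _ _ V) => //; rewrite /V.
  move=> u v; rewrite innerZl innerZr inner_plane_wave dft_plane_wave innerZr.
  rewrite conj_realC conjC_nat -(rmorph_nat (real_complex R)) !mulrA -!rmorphM.
  rewrite -expr2 exprVn sqr_sqrtr ?ler0n// mulVf ?mul1r// pnatr_eq0 -lt0n//.
by move=> u; rewrite opZ circmx_plane_wave.
Qed.

Lemma circmx_numerical_bound (m : R) :
  (forall k u, `|'[symbol k u, u]| <= m%:C * `|u| ^+ 2) ->
  forall x, `|'[C x, x]| <= m%:C * `|x| ^+ 2.
Proof.
move=> Sm x; rewrite circmx_form normr_inner dft_parseval normrM normfV.
rewrite normr_nat mulrCA ler_wpM2l ?invr_ge0 ?ler0n//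
  (le_trans (ler_norm_sum _ _ _))//.
by rewrite mulr_sumr ler_sum// => k _; rewrite -normr_inner.
Qed.

End Circulant.

(** * Comparison of the radii *)

Theorem theorem4p1 (R : realType) (H : hilbertType R) (n : nat) (n_gt0 : (0 < n)%N)
    (S : 'I_n -> 'B(H)) (q : R) (q_gt0 : 0 < q) (q_le1 : q <= 1) :
  let mu : R := \big[Num.max/0]_(k < n)
    qnum_radius q%:C (\sum_(j < n) omega R n ^ (k%:Z * (1 - j.+1%:Z)) *: S j) in
  mu <= qnum_radius q%:C (opmx (circmx S))
     <= (q + 2 * Num.sqrt (1 - q ^+ 2)) / q * mu.
Proof.
have q01 : 0 <= q <= 1 by rewrite ltW.
have prim : n.-primitive_root (omega R n)^-1.
  exact: primitive_rootV (omega_primitive R n_gt0).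
have symbolE (k : 'I_n) :
    \sum_(j < n) omega R n ^ (k%:Z * (1 - j.+1%:Z)) *: S j =
    symbol S (omega R n)^-1 k.
  apply: eq_bigr => j _; congr (_ *: _).
  by rewrite -addn1 PoszD opprD addrC subrK mulrN -PoszM -exprnN exprVn.
lazy zeta; set mu := \big[_/_]_(_ < _) _.
have muE : mu = \big[Num.max/0]_(k < n)
    qnum_radius q%:C (symbol S (omega R n)^-1 k).
  by apply: eq_bigr => k _; rewrite symbolE.
apply/andP; split.
  rewrite muE; apply: bigmax_le => [|k _]; first exact: qnum_radius_ge0.
  exact: qnum_radius_symbol_le.
have mu0 : 0 <= mu by exact: bigmax_ge_id.
rewrite -mulrA; apply: qnum_radius_le => //; last first.
  by rewrite mulr_ge0// invr_ge0 ltW.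
apply: (circmx_numerical_bound prim) => k u.
have qmu : q%:C * (q^-1 * mu)%:C = mu%:C by rewrite -rmorphM mulVKf ?gt_eqF.
rewrite -(ler_pM2l (_ : 0 < q%:C)) ?ltcR// mulrA qmu.
rewrite (le_trans (quadratic_form_le_qnum_radius _ _ q01))//.
rewrite ler_wpM2r ?exprn_ge0// lecR muE.
exact: le_bigmax.
Qed.
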